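(* Let $X\in\{0,1\}$ be binary. Assume consistency $Y=Y_X$, conditional ignorability $(Y_0,Y_1)\perp X\mid\boldsymbol Z$, and positivity $0<P(X=1\mid\boldsymbol Z=\boldsymbol z)<1$ for all $\boldsymbol z$. Then $$\mathcal{CI}_X=e_{\mathrm{cond}}-e_{\mathrm{orig}}=2\,\mathbb E_{\boldsymbol Z}\Big(\mathbb V(X\mid\boldsymbol Z)\big[\mathbb E(Y_1\mid\boldsymbol Z)-\mathbb E(Y_0\mid\boldsymbol Z)\big]^2\Big).$$
   Context: Let $O=(Y,X,\boldsymbol Z)$ be a random vector with real outcome $Y$, $\mathbb E[Y^2]<\infty$, predictor/treatment $X$ and covariate vector $\boldsymbol Z$, and $f_0(x,\boldsymbol z)=\mathbb E(Y\mid X=x,\boldsymbol Z=\boldsymbol z)$. Let $(Y^{(a)},X^{(a)},\boldsymbol Z)$ have the law of $O$, and let $X^{(b)}$ be, conditionally on $\boldsymbol Z$, distributed as $X\mid\boldsymbol Z$ and conditionally independent of $(Y^{(a)},X^{(a)})$ given $\boldsymbol Z$. Define $e_{\mathrm{orig}}=\mathbb E[(Y^{(a)}-f_0(X^{(a)},\boldsymbol Z))^2]$, $e_{\mathrm{cond}}=\mathbb E[(Y^{(a)}-f_0(X^{(b)},\boldsymbol Z))^2]$ (assumed finite), and the Conditional Variable Importance Metric (CVIM) $\mathcal{CI}_X=e_{\mathrm{cond}}-e_{\mathrm{orig}}$. $Y_x$ denotes the potential outcome under $X=x$. *)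

(* Defs.v *)
From HB Require Import structures.
From mathcomp Require Import all_boot all_order all_algebra.
From mathcomp Require Import all_classical all_reals all_analysis.
Set Implicit Arguments. Unset Strict Implicit. Unset Printing Implicit Defensive.
Import Order.TTheory GRing.Theory Num.Theory.
Local Open Scope classical_set_scope.
Local Open Scope ring_scope.

Definition cond_exp_version d (T : measurableType d) (R : realType)
  (P : probability T R) dW (TW : measurableType dW)
  (W : T -> TW) (V : T -> R) (g : TW -> R) : Prop :=
  [/\ P.-integrable setT (EFin \o V),
      measurable_fun setT g,
      P.-integrable setT (EFin \o (g \o W)) &
      forall C, measurable C ->
        (\int[P]_(t in W @^-1` C) (V t)%:E =
         \int[P]_(t in W @^-1` C) (g (W t))%:E)%E].

Definition cond_indep d (T : measurableType d) (R : realType)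
  (P : probability T R)
  dU (TU : measurableType dU) dV (TV : measurableType dV)
  dW (TW : measurableType dW)
  (U : T -> TU) (V : T -> TV) (W : T -> TW) : Prop :=
  forall (A : set TU) (B : set TV), measurable A -> measurable B ->
  exists gA gB : TW -> R,
    [/\ cond_exp_version P W (\1_(U @^-1` A) : T -> R) gA,
        cond_exp_version P W (\1_(V @^-1` B) : T -> R) gB &
        cond_exp_version P W (\1_(U @^-1` A `&` V @^-1` B) : T -> R)
          (fun w => gA w * gB w)].

Definition same_cond_law d (T : measurableType d) (R : realType)
  (P : probability T R) dU (TU : measurableType dU)
  dW (TW : measurableType dW) (U U' : T -> TU) (W : T -> TW) : Prop :=
  forall B : set TU, measurable B ->
  exists g : TW -> R,
    cond_exp_version P W (\1_(U @^-1` B) : T -> R) g /\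
    cond_exp_version P W (\1_(U' @^-1` B) : T -> R) g.

(* Main.v *)
(* Let [f1 z = f0 (1, z)], [fz z = f0 (0, z)], [g = f0 (X, Z)] and
   [del = f1 - fz].  Given [(Y, X, Z)], the copy [Xb] equals 1 with probability
   [e Z], so e_cond is the integral of
     [F = e (Y - f1)^2 + (1 - e) (Y - fz)^2].
   Pointwise, [F = (Y - g)^2 + 2 (Y - g) del (X - e) + K] with
   [K = (X (1 - e) + (1 - X) e) del^2].  The cross term integrates to 0 because
   [g] is the conditional expectation of [Y] given [(X, Z)], and [K] integrates
   to that of [2 e (1 - e) del^2].  Finally [v = e (1 - e)] as [X] is binary,
   and [f1 = mu1], [fz = mu0] by ignorability and positivity.  Integrability of
   the pieces comes down to [g] being square integrable: [g] and [f0 (Xb, Z)]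
   have the same second moment. *)
Require Import Defs.
From HB Require Import structures.
From mathcomp Require Import all_boot all_order all_algebra.
From mathcomp Require Import all_classical all_reals all_analysis.
From mathcomp Require Import measurable_realfun ring lra.
Import Order.TTheory GRing.Theory Num.Theory.
Import HBNNSimple.
Local Open Scope classical_set_scope.
Local Open Scope ring_scope.

(** * Integrals of real-valued functions on a probability space *)

Section real_integrals.
Context {R : realType} {d : measure_display} {T : measurableType d}
  {P : probability T R}.

Lemma le_integrable_EFin (f g : T -> R) : measurable_fun setT f ->
  (forall t, `|f t| <= `|g t|) -> P.-integrable setT (EFin \o g) ->
  P.-integrable setT (EFin \o f).
Proof.
move=> mf fg; apply: le_integrable => //; first exact/measurable_EFinP.
by move=> t _ /=; rewrite lee_fin.
Qed.

Lemma sube_eq0 (x y : \bar R) : x \is a fin_num -> y \is a fin_num ->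
  (x - y = 0)%E -> x = y.
Proof. by case: x y => [x| |] [y| |]// _ _ [] /eqP; rewrite subr_eq0 => /eqP ->. Qed.

Lemma integral_EFin_fin_num (f : T -> R) :
  P.-integrable setT (EFin \o f) -> (\int[P]_t (f t)%:E)%E \is a fin_num.
Proof. exact: integrable_fin_num. Qed.

Lemma integralB_real (f g : T -> R) :
  P.-integrable setT (EFin \o f) -> P.-integrable setT (EFin \o g) ->
  (\int[P]_t (f t - g t)%:E = \int[P]_t (f t)%:E - \int[P]_t (g t)%:E)%E.
Proof.
by move=> fi gi; rewrite -integralB_EFin//; apply: eq_integral.
Qed.

Lemma integralD_real (f g : T -> R) :
  P.-integrable setT (EFin \o f) -> P.-integrable setT (EFin \o g) ->
  (\int[P]_t (f t + g t)%:E = \int[P]_t (f t)%:E + \int[P]_t (g t)%:E)%E.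
Proof.
by move=> fi gi; rewrite -integralD_EFin//; apply: eq_integral.
Qed.

Lemma integrable_measurable (f : T -> R) :
  P.-integrable setT (EFin \o f) -> measurable_fun setT f.
Proof. by move=> /measurable_int/measurable_EFinP. Qed.

Lemma integrable_mul_indic (f : T -> R) (A : set T) : measurable A ->
  P.-integrable setT (EFin \o f) ->
  P.-integrable setT (EFin \o (fun t => f t * \1_A t)).
Proof.
move=> mA fi; apply: (le_integrable_EFin _ f).
- by apply: measurable_funM => //; exact: integrable_measurable.
- move=> t; rewrite normrM ler_piMr// indicE.
  by case: (_ \in _); rewrite /= ?normr1 ?normr0.
- by [].
Qed.

Lemma integrable_mul_bounded (f h : T -> R) : measurable_fun setT h ->
  (forall t, `|h t| <= 1) -> P.-integrable setT (EFin \o f) ->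
  P.-integrable setT (EFin \o (fun t => f t * h t)).
Proof.
move=> mh h1 fi; apply: (le_integrable_EFin _ f) => //.
  by apply: measurable_funM => //; exact: integrable_measurable fi.
by move=> t; rewrite normrM ler_piMr.
Qed.

Lemma normr_indic_le1 {S : Type} (A : set S) (s : S) : `|\1_A s| <= 1 :> R.
Proof. by rewrite indicE; case: (_ \in _); rewrite /= ?normr1 ?normr0. Qed.

Lemma integral_setC (f : T -> R) (A : set T) : measurable A ->
  P.-integrable setT (EFin \o f) ->
  (\int[P]_(t in ~` A) (f t)%:E = \int[P]_t (f t)%:E - \int[P]_(t in A) (f t)%:E)%E.
Proof.
move=> mA fi.
have mf : measurable_fun setT (EFin \o f) by exact: measurable_int fi.
have fiA : (\int[P]_(t in A) (f t)%:E)%E \is a fin_num.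
  by apply: integrable_fin_num => //; exact: integrableS fi.
rewrite -[in X in (X - _)%E](setUv A) integral_setU//.
- by rewrite addeAC subee// add0e.
- exact: measurableC.
- by rewrite setUv.
- by apply/disj_setPS => t [].
Qed.

End real_integrals.

(** * Versions of conditional expectation: pulling out factors, uniqueness *)

Section conditional_expectation.
Context {R : realType} {d : measure_display} {T : measurableType d}
  (P : probability T R) {dW : measure_display} {TW : measurableType dW}
  (W : T -> TW) (mW : measurable_fun setT W).

Lemma measurable_preimage C : measurable C -> measurable (W @^-1` C).
Proof. by move=> mC; rewrite -[_ @^-1` _]setTI; exact: mW. Qed.

(** Turns the test against [C] in [cond_exp_version] into an integral over the whole space with a
    factor depending on [W] only, the shape in which factors are pulled out. *)
Lemma integral_preimage (F : T -> R) C : measurable C ->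
  (\int[P]_(t in W @^-1` C) (F t)%:E = \int[P]_t (F t * \1_C (W t))%:E)%E.
Proof.
move=> mC; rewrite integral_mkcond; apply: eq_integral => t _.
rewrite patchE indicE; case: ifPn => [|]; rewrite ?inE /= => h.
  by rewrite mem_set// mulr1.
rewrite memNset ?mulr0// => h'.
by move/negP: h; rewrite inE.
Qed.

(** A simple function is the sum of its values times the indicators of its level sets. The level
    sets of [h \o W] are preimages under [W], so only integrals over such preimages remain. *)
Lemma ge0_integral_nnsfun_comp (F : T -> R) (h : {nnsfun TW >-> R}) :
  measurable_fun setT F -> (forall t, 0 <= F t) ->
  (\int[P]_t (F t * h (W t))%:E =
   \sum_(y \in range h) y%:E * \int[P]_(t in W @^-1` (h @^-1` [set y])) (F t)%:E)%E.
Proof.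
move=> mF F0.
transitivity (\int[P]_t \sum_(y \in range h)
    (y%:E * (F t * \1_(h @^-1` [set y]) (W t))%:E))%E.
  apply: eq_integral => t _.
  rewrite fsbig_finite//= {1}fimfunE fsbig_finite//= mulr_sumr -sumEFin.
  apply: eq_bigr => y _.
  by rewrite -EFinM mulrCA.
rewrite ge0_integral_fsum//.
- apply: eq_fsbigr => y; rewrite inE => -[w _ hw].
  rewrite ge0_integralZl_EFin//.
  + by rewrite integral_preimage.
  + by move=> t _; rewrite lee_fin mulr_ge0.
  + apply/measurable_EFinP/measurable_funM => //.
    exact: measurableT_comp.
  + by rewrite -hw.
- move=> y; apply: measurable_funeM.
  apply/measurable_EFinP/measurable_funM => //.
  exact: measurableT_comp.
(* Nonnegativity of the summands is required for every real [y], not only those in the range; for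
   [y < 0] the level set of the nonnegative [h] is empty and the summand is 0. *)
- move=> y t _; have [y0|y0] := leP 0 y.
    by rewrite mule_ge0// lee_fin mulr_ge0.
  rewrite preimage_nnfun0// indic0 mulr0 mule0//.
Qed.

(** Agreement on the preimages of measurable sets passes to simple functions by linearity, then to
    [phi] by monotone convergence along its simple approximations. *)
Lemma eq_ge0_integral_comp (F G : T -> R) (phi : TW -> R) :
  measurable_fun setT F -> measurable_fun setT G ->
  (forall t, 0 <= F t) -> (forall t, 0 <= G t) ->
  (forall C, measurable C ->
    (\int[P]_(t in W @^-1` C) (F t)%:E = \int[P]_(t in W @^-1` C) (G t)%:E)%E) ->
  measurable_fun setT phi -> (forall w, 0 <= phi w) ->
  (\int[P]_t (F t * phi (W t))%:E = \int[P]_t (G t * phi (W t))%:E)%E.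
Proof.
move=> mF mG F0 G0 FG mphi phi0.
have mphi' : measurable_fun setT (EFin \o phi) by exact/measurable_EFinP.
pose h := nnsfun_approx measurableT mphi'.
have key (H : T -> R) : measurable_fun setT H -> (forall t, 0 <= H t) ->
    (\int[P]_t (H t * phi (W t))%:E =
     limn (fun n => \int[P]_t (H t * h n (W t))%:E))%E.
  move=> mH H0.
  rewrite -monotone_convergence//.
  - apply: eq_integral => t _; apply/esym/cvg_lim => //.
    under eq_fun do rewrite EFinM.
    rewrite EFinM; apply: cvgeZl => //.
    by apply: (cvg_nnsfun_approx measurableT mphi') => // w _; rewrite lee_fin.
  - move=> n; apply/measurable_EFinP/measurable_funM => //.
    exact: measurableT_comp.
  - by move=> n t _; rewrite lee_fin mulr_ge0.
  - move=> t _ a b ab; rewrite lee_fin ler_wpM2l//.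
    by apply/lefP/nd_nnsfun_approx.
rewrite !key//; congr (limn _); apply/funext => n.
rewrite !ge0_integral_nnsfun_comp//; apply: eq_fsbigr => y _.
by rewrite FG.
Qed.

Lemma cond_exp_version_pull (V : T -> R) (g phi : TW -> R) :
  cond_exp_version P W V g -> measurable_fun setT phi ->
  P.-integrable setT (fun t => ((V t - g (W t)) * phi (W t))%:E) ->
  (\int[P]_t ((V t - g (W t)) * phi (W t))%:E = 0)%E.
Proof.
move=> [Vi mg gi Vg] mphi Uphi.
pose U t := V t - g (W t).
have Ui : P.-integrable setT (EFin \o U).
  exact: (integrableB measurableT Vi gi).
have mU := integrable_measurable _ Ui.
pose pos (x : R) := Num.max x 0.
have mpos (f : T -> R) (mf : measurable_fun setT f) :
    measurable_fun setT (fun t : T => pos (f t)).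
  exact: measurable_maxr.
have mpos' (f : TW -> R) (mf : measurable_fun setT f) :
    measurable_fun setT (fun t : TW => pos (f t)).
  exact: measurable_maxr.
have pos0 x : 0 <= pos x by rewrite le_max lexx orbT.
have posE x : x = pos x - pos (- x).
  by rewrite /pos; case: (leP x 0); case: (leP (- x) 0); lra.
have pos_le x : `|pos x| <= `|x|.
  by rewrite ger0_norm// /pos; case: (leP x 0) => // x0; rewrite ger0_norm// ltW.
have posN_le x : `|pos (- x)| <= `|x| by rewrite -(normrN x) pos_le.
have mNU : measurable_fun setT (fun t => - U t).
  exact: measurableT_comp.
have mNphi : measurable_fun setT (fun t => - phi t).
  exact: measurableT_comp.
have Upi : P.-integrable setT (EFin \o (fun t => pos (U t))).
  by apply: (le_integrable_EFin _ U) => //; exact: mpos.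
have Uni : P.-integrable setT (EFin \o (fun t => pos (- U t))).
  by apply: (le_integrable_EFin _ U) => //; exact: mpos.
(* [U] has zero mean on every [W @^-1` C], so its positive and negative parts
   induce the same measure on [TW]. *)
have posU C : measurable C -> (\int[P]_(t in W @^-1` C) (pos (U t))%:E =
    \int[P]_(t in W @^-1` C) (pos (- U t))%:E)%E.
  move=> mC; have mWC := measurable_preimage C mC.
  rewrite !integral_preimage//.
  have Upi' := integrable_mul_indic _ _ mWC Upi.
  have Uni' := integrable_mul_indic _ _ mWC Uni.
  have Vi' := integrable_mul_indic _ _ mWC Vi.
  have gi' := integrable_mul_indic _ _ mWC gi.
  apply: sube_eq0; [exact: integral_EFin_fin_num..|].
  rewrite -integralB_real//.
  under eq_integral do rewrite -mulrBl -posE /U mulrBl.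
  rewrite integralB_real//.
  have := Vg C mC; rewrite !integral_preimage// => ->.
  by rewrite subee//; exact: integral_EFin_fin_num gi'.
have cW (f : TW -> R) (mf : measurable_fun setT f) :
    measurable_fun setT (fun t => f (W t)).
  exact: measurableT_comp.
(* All four products of a part of [U] with a part of [phi] are dominated by the integrable
   [U * phi]. *)
have Ie (a : T -> R) (b : TW -> R) :
   measurable_fun setT a -> (forall t, `|a t| <= `|U t|) ->
   measurable_fun setT b -> (forall t, `|b t| <= `|phi t|) ->
   P.-integrable setT (EFin \o (fun t => a t * b (W t))).
  move=> ma aU mb bphi; apply: (le_integrable_EFin _ (fun t => U t * phi (W t))) => //.
    by apply: measurable_funM => //; exact: cW.
  by move=> t; rewrite !normrM ler_pM.
(* The product of the two decompositions into positive and negative parts, grouped by the part of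
   [phi]: each group has zero integral because both parts of [U] integrate alike against a
   nonnegative function of [W]. *)
transitivity ((\int[P]_t ((pos (U t) * pos (phi (W t)) - pos (- U t) * pos (phi (W t)))
   - (pos (U t) * pos (- phi (W t)) - pos (- U t) * pos (- phi (W t))))%:E)%E).
  apply: eq_integral => t _; congr EFin.
  rewrite -/(U t) {1}(posE (U t)) {1}(posE (phi (W t))); ring.
have I1 := Ie _ _ (mpos _ mU) (fun t => pos_le _) (mpos' _ mphi) (fun t => pos_le _).
have I2 := Ie _ _ (mpos _ mU) (fun t => pos_le _) (mpos' _ mNphi) (fun t => posN_le _).
have I3 := Ie _ _ (mpos _ mNU) (fun t => posN_le _) (mpos' _ mphi) (fun t => pos_le _).
have I4 := Ie _ _ (mpos _ mNU) (fun t => posN_le _) (mpos' _ mNphi) (fun t => posN_le _).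
rewrite integralB_real; [|exact: (integrableB measurableT I1 I3)
  |exact: (integrableB measurableT I2 I4)].
rewrite !integralB_real//.
rewrite (eq_ge0_integral_comp (fun t => pos (U t)) (fun t => pos (- U t))
  (fun w => pos (phi w)))//; [|exact: mpos..|exact: mpos'].
rewrite (eq_ge0_integral_comp (fun t => pos (U t)) (fun t => pos (- U t))
  (fun w => pos (- phi w)))//; [|exact: mpos..|exact: mpos'].
rewrite !subee ?sube0//.
- exact: integral_EFin_fin_num I4.
- exact: integral_EFin_fin_num I3.
Qed.

Lemma cond_exp_version_pull_out (V : T -> R) (g phi : TW -> R) :
  cond_exp_version P W V g -> measurable_fun setT phi ->
  P.-integrable setT (EFin \o (fun t => V t * phi (W t))) ->
  P.-integrable setT (EFin \o (fun t => g (W t) * phi (W t))) ->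
  (\int[P]_t (V t * phi (W t))%:E = \int[P]_t (g (W t) * phi (W t))%:E)%E.
Proof.
move=> Vg mphi iV ig.
apply: sube_eq0; [exact: integral_EFin_fin_num..|].
rewrite -integralB_real//.
under eq_integral do rewrite -mulrBl.
apply: cond_exp_version_pull => //.
by under eq_fun do rewrite mulrBl; exact: (integrableB measurableT iV ig).
Qed.

(** By nonnegativity both sides may be infinite, so finiteness of one side can be used to prove
    integrability on the other. *)
Lemma cond_exp_version_ge0_pull (V : T -> R) (g phi : TW -> R) :
  cond_exp_version P W V g -> (forall t, 0 <= V t) -> (forall w, 0 <= g w) ->
  measurable_fun setT phi -> (forall w, 0 <= phi w) ->
  (\int[P]_t (V t * phi (W t))%:E = \int[P]_t (g (W t) * phi (W t))%:E)%E.
Proof.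
move=> [Vi mg gi Vg] V0 g0 mphi phi0.
apply: eq_ge0_integral_comp => //; first exact: integrable_measurable Vi.
exact: integrable_measurable gi.
Qed.

(** [g'] is also a version for [g \o W]. Testing the difference [u] of the two against its own sign
    gives that the integral of [|u \o W|] vanishes. *)
Lemma cond_exp_version_unique (V : T -> R) (g g' : TW -> R) :
  cond_exp_version P W V g -> cond_exp_version P W V g' ->
  {ae P, forall t, g (W t) = g' (W t)}.
Proof.
move=> [Vi mg gi Vg] [_ mg' gi' Vg'].
have gg' : cond_exp_version P W (g \o W) g'.
  by split => // C mC; rewrite -Vg// Vg'.
pose u w := g w - g' w.
have mu : measurable_fun setT u by exact: measurable_funB.
have ui : P.-integrable setT (EFin \o (u \o W)).
  exact: (integrableB measurableT gi gi').
(* [phi] is the sign of [u], so that [u * phi = `|u|]. *)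
pose phi w : R := \1_(u @^-1` `[0, +oo[) w *+ 2 - 1.
have mS : measurable (u @^-1` `[0, +oo[).
  by rewrite -[_ @^-1` _]setTI; exact: mu.
have mphi : measurable_fun setT phi.
  apply: measurable_funB => //; under eq_fun do rewrite mulr2n.
  exact: measurable_funD.
have uphi w : u w * phi w = `|u w|.
  rewrite /phi indicE; case: (boolP (_ \in _)) => [/set_mem|/negP h]/=.
    by rewrite in_itv/= andbT => u0; rewrite ger0_norm//; lra.
  have u0 : u w < 0.
    by rewrite ltNge; apply/negP => u0; apply/h/mem_set; rewrite /= in_itv/= u0.
  by rewrite ltr0_norm//; lra.
have := cond_exp_version_pull _ _ _ gg' mphi.
under eq_fun do rewrite /= uphi.
move=> /(_ (integrable_abse ui)) h.
have : (\int[P]_t `|(EFin \o (u \o W)) t| = 0)%E.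
  by rewrite -[RHS]h; apply: eq_integral.
move/(ae_eq_integral_abs _ measurableT (measurable_int _ ui)).
apply: filterS => t /(_ Logic.I)/= [] /eqP.
by rewrite subr_eq0 => /eqP.
Qed.

Lemma cond_exp_version_eq (V V' : T -> R) (g : TW -> R) :
  P.-integrable setT (EFin \o V') ->
  (forall C, measurable C ->
    \int[P]_(t in W @^-1` C) (V' t)%:E = \int[P]_(t in W @^-1` C) (V t)%:E)%E ->
  cond_exp_version P W V g -> cond_exp_version P W V' g.
Proof. by move=> V'i VV' [_ mg gi Vg]; split => // C mC; rewrite VV'// Vg. Qed.

Lemma cond_exp_version_onem (V : T -> R) (g : TW -> R) :
  cond_exp_version P W V g ->
  cond_exp_version P W (fun t => 1 - V t) (fun w => 1 - g w).
Proof.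
move=> [Vi mg gi Vg].
have i1 : P.-integrable setT (EFin \o cst 1) by exact: finite_measure_integrable_cst.
split.
- exact: (integrableB measurableT i1 Vi).
- exact: measurable_funB.
- exact: (integrableB measurableT i1 gi).
move=> C mC; have mWC : measurable (W @^-1` C) by exact: measurable_preimage.
have iC : P.-integrable setT (EFin \o (fun t => \1_C (W t) : R)).
  have := integrable_mul_indic _ _ mWC i1.
  by under eq_fun do rewrite /= mul1r.
have := Vg C mC; rewrite !(integral_preimage)// => h.
under eq_integral do rewrite mulrBl mul1r.
under [RHS]eq_integral do rewrite mulrBl mul1r.
rewrite (integralB_real _ _ iC (integrable_mul_indic _ _ mWC Vi)).
rewrite (integralB_real _ _ iC (integrable_mul_indic _ _ mWC gi)).
by rewrite h.
Qed.

(** Meant for a function of a binary variable, split over its two values: [V1] and [V2] are the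
    indicators of the values, [g1] and [g2] their conditional probabilities. *)
Lemma ge0_integral_pull2 (V1 V2 : T -> R) (g1 g2 phi1 phi2 : TW -> R) :
  cond_exp_version P W V1 g1 -> cond_exp_version P W V2 g2 ->
  (forall t, 0 <= V1 t) -> (forall t, 0 <= V2 t) ->
  (forall w, 0 <= g1 w) -> (forall w, 0 <= g2 w) ->
  measurable_fun setT phi1 -> measurable_fun setT phi2 ->
  (forall w, 0 <= phi1 w) -> (forall w, 0 <= phi2 w) ->
  (\int[P]_t (V1 t * phi1 (W t) + V2 t * phi2 (W t))%:E =
   \int[P]_t (g1 (W t) * phi1 (W t) + g2 (W t) * phi2 (W t))%:E)%E.
Proof.
move=> Vg1 Vg2 V10 V20 g10 g20 mphi1 mphi2 phi10 phi20.
have [Vi1 mg1 _ _] := Vg1; have [Vi2 mg2 _ _] := Vg2.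
have cW (f : TW -> R) : measurable_fun setT f -> measurable_fun setT (fun t => f (W t)).
  by move=> ?; exact: measurableT_comp.
have mV1 := integrable_measurable _ Vi1; have mV2 := integrable_measurable _ Vi2.
have mM (f g : T -> R) : measurable_fun setT f -> measurable_fun setT g ->
    measurable_fun setT (fun t => (f t * g t)%:E).
  by move=> mf mg; apply/measurable_EFinP; exact: measurable_funM.
under eq_integral do rewrite EFinD.
under [RHS]eq_integral do rewrite EFinD.
rewrite ge0_integralD//; [|by move=> t _; rewrite lee_fin mulr_ge0|
  by apply: mM => //; exact: cW|by move=> t _; rewrite lee_fin mulr_ge0|
  by apply: mM => //; exact: cW].
rewrite ge0_integralD//; [|by move=> t _; rewrite lee_fin mulr_ge0|
  by apply: mM; exact: cW|by move=> t _; rewrite lee_fin mulr_ge0|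
  by apply: mM; exact: cW].
by congr (_ + _)%E; exact: cond_exp_version_ge0_pull.
Qed.

End conditional_expectation.

(** * Conditional independence, identification of the regression arms, conditional variance of a
    binary variable *)

Section conditional_independence.
Context {R : realType} {d : measure_display} {T : measurableType d}
  (P : probability T R).

Lemma cond_indepC {dU} {TU : measurableType dU} {dV} {TV : measurableType dV}
    {dW} {TW : measurableType dW} (U : T -> TU) (V : T -> TV) (W : T -> TW) :
  cond_indep P U V W -> cond_indep P V U W.
Proof.
move=> UV B A mB mA; have [gA [gB [hA hB hAB]]] := UV A B mA mB.
exists gB, gA; split=> //; rewrite setIC.
by under eq_fun do rewrite mulrC.
Qed.

Lemma same_cond_law_version {dU} {TU : measurableType dU}
    {dW} {TW : measurableType dW} (U U' : T -> TU) (W : T -> TW) B (g : TW -> R) :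
  same_cond_law P U U' W -> measurable B ->
  cond_exp_version P W (\1_(U @^-1` B) : T -> R) g ->
  cond_exp_version P W (\1_(U' @^-1` B) : T -> R) g.
Proof.
move=> UU' mB; have [h [[_ _ _ hU] [iU' _ _ hU']]] := UU' B mB.
by apply: cond_exp_version_eq => // C mC; rewrite hU'// -hU.
Qed.

(* Conditional independence restated as: further conditioning on [U] does not
   change the conditional probability of [V @^-1` B] given [W]. *)
Lemma cond_indep_version {dU} {TU : measurableType dU} {dV} {TV : measurableType dV}
    {dW} {TW : measurableType dW} (U : T -> TU) (V : T -> TV) (W : T -> TW)
    (B : set TV) (e : TW -> R) :
  measurable_fun setT U -> measurable_fun setT W ->
  cond_indep P U V W -> measurable B ->
  cond_exp_version P W (\1_(V @^-1` B) : T -> R) e ->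
  (forall w, 0 <= e w <= 1) ->
  cond_exp_version P (fun t => (U t, W t)) (\1_(V @^-1` B) : T -> R)
    (fun x => e x.2).
Proof.
move=> mU mW UV mB Ve e01; have [Vi me ei VeC] := Ve.
have e0 w : 0 <= e w by case/andP: (e01 w).
have e1 w : `|e w| <= 1 by rewrite ger0_norm//; case/andP: (e01 w).
have mUW : measurable_fun setT (fun t => (U t, W t)) by exact: measurable_fun_pair.
split => //; first exact: measurableT_comp.
rewrite (_ : measurable = @measurable _ (TU * TW)%type)//.
rewrite measurable_prod_measurableType.
(* Rectangles form a pi-system generating the product sigma-algebra, and the test sets satisfying
   the identity are closed under complement and countable disjoint union. *)
apply: dynkin_induction => /=.
- exact: measurable_prod_measurableType.
- move=> _ _ [A1 mA1 [A2 mA2 <-]] [B1 mB1 [B2 mB2 <-]].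
  exists (A1 `&` B1); first exact: measurableI.
  exists (A2 `&` B2); first exact: measurableI.
  by rewrite setXI.
- by rewrite preimage_setT; have := VeC setT measurableT; rewrite preimage_setT.
- move=> _ [A mA [C mC <-]].
  have [gA [gB [hA hB hAB]]] := UV A B mA mB.
  have mUA : measurable (U @^-1` A) by exact: measurable_preimage.
  have mWC : measurable (W @^-1` C) by exact: measurable_preimage.
  have -> : (fun t => (U t, W t)) @^-1` (A `*` C) = U @^-1` A `&` W @^-1` C by [].
  transitivity (\int[P]_(t in W @^-1` C) (gA (W t) * e (W t))%:E)%E.
    transitivity (\int[P]_(t in W @^-1` C) (\1_(U @^-1` A `&` V @^-1` B) t)%:E)%E.
      rewrite [LHS]integral_mkcond [RHS]integral_mkcond; apply: eq_integral => t _.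
      rewrite !patchE !in_setI indicE indicI /= indicE.
      by case: (t \in U @^-1` A); case: (t \in W @^-1` C); rewrite ?mul1r ?mul0r//=.
    have [_ _ _ ->//] := hAB.
    have [_ mgA gAi _] := hA; have [_ mgB gBi _] := hB.
    apply: ae_eq_integral => //.
    + apply/measurable_EFinP/measurable_funTS/measurable_funM; exact: measurableT_comp.
    + apply/measurable_EFinP/measurable_funTS/measurable_funM; exact: measurableT_comp.
    + have := cond_exp_version_unique P W mW _ _ _ hB Ve.
      by apply: filterS => t -> _.
  have [UAi mgA gAi _] := hA.
  pose phi w := e w * \1_C w.
  have mphi : measurable_fun setT phi by exact: measurable_funM.
  have phi1 w : `|phi w| <= 1.
    by rewrite normrM mulr_ile1// indicE; case: (_ \in _); rewrite ?normr1 ?normr0.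
  have iphi (f : T -> R) : P.-integrable setT (EFin \o f) ->
      P.-integrable setT (EFin \o (fun t => f t * phi (W t))).
    move=> fi; apply: (le_integrable_EFin _ f) => //.
    + by apply: measurable_funM; [exact: integrable_measurable fi|exact: measurableT_comp].
    + by move=> t; rewrite normrM ler_piMr.
  have h := cond_exp_version_pull_out P W mW _ _ _ hA mphi (iphi _ UAi) (iphi _ gAi).
  rewrite integral_preimage//.
  transitivity (\int[P]_t (gA (W t) * phi (W t))%:E)%E.
    by apply: eq_integral => t _; rewrite /phi mulrA.
  rewrite -h [RHS]integral_mkcond; apply: eq_integral => t _.
  rewrite patchE in_setI indicE /phi indicE.
  have -> : (W t \in C) = (t \in W @^-1` C) by [].
  by case: (t \in U @^-1` A); case: (t \in W @^-1` C); rewrite ?mul1r ?mul0r ?mulr1 ?mulr0.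
- move=> S mS; rewrite -preimage_setC => h.
  have mS' : measurable ((fun t => (U t, W t)) @^-1` S) by exact: measurable_preimage.
  rewrite (integral_setC _ _ mS' Vi) (integral_setC _ _ mS' ei) h; congr (_ - _)%E.
  by have := VeC setT measurableT; rewrite preimage_setT.
- move=> F mF tF h; rewrite preimage_bigcup.
  have mF' k : measurable ((fun t => (U t, W t)) @^-1` F k).
    exact: measurable_preimage.
  have tF' : trivIset setT (fun k => (fun t => (U t, W t)) @^-1` F k).
    apply/trivIsetP => i j _ _ ij.
    by rewrite -preimage_setI; move/trivIsetP : tF => ->//; exact: preimage_set0.
  rewrite !ge0_integral_bigcup//.
  + exact: eq_eseriesr.
  + apply/measurable_EFinP/measurable_funTS; exact: measurableT_comp.
  + by move=> t _; rewrite lee_fin.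
  + apply/measurable_EFinP/measurable_funTS; exact: integrable_measurable Vi.
Qed.

(** Serves both arms: [U] will be [(Y0, Y1)], [p] the projection to the arm, and [ex] either [e] or
    [1 - e]. On the event [X = x] the outcome is [p (U t)], and given [Z] that event carries no
    information on [U]; positivity of [ex] then determines [f0 (x, Z t)] almost surely. *)
Lemma regression_arm {dZ} {TZ : measurableType dZ} {dU} {TU : measurableType dU}
    (X Y : T -> R) (Z : T -> TZ) (U : T -> TU) (p : TU -> R) (x : R)
    (f0 : R * TZ -> R) (ex mux : TZ -> R) :
  measurable_fun setT X -> measurable_fun setT Z -> measurable_fun setT U ->
  measurable_fun setT p ->
  (forall t, X t = x -> Y t = p (U t)) ->
  cond_exp_version P (fun t => (X t, Z t)) Y f0 ->
  cond_indep P U X Z ->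
  cond_exp_version P Z (\1_(X @^-1` [set x]) : T -> R) ex ->
  (forall z, 0 < ex z < 1) ->
  cond_exp_version P Z (p \o U) mux ->
  {ae P, forall t, f0 (x, Z t) = mux (Z t)}.
Proof.
move=> mX mZ mU mp Yp Yf UX Xex ex01 pmu.
have [Yi mf fi Yf'] := Yf; have [Ii mex exi _] := Xex; have [pi mmu mui _] := pmu.
have ex0 z : 0 <= ex z by case/andP: (ex01 z) => /ltW.
have ex1 z : `|ex z| <= 1 by rewrite ger0_norm//; case/andP: (ex01 z) => _ /ltW.
pose I : T -> R := \1_(X @^-1` [set x]).
have mI : measurable_fun setT I by exact: integrable_measurable Ii.
have I1 t : `|I t| <= 1 by exact: normr_indic_le1.
have I_eq (a b : T -> R) : (forall t, X t = x -> a t = b t) ->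
    forall t, I t * a t = I t * b t.
  move=> ab t; rewrite /I indicE; case: (boolP (_ \in _)) => [/set_mem/= /ab ->//|_].
  by rewrite !mul0r.
have cZ (f : TZ -> R) : measurable_fun setT f -> measurable_fun setT (fun t => f (Z t)).
  by move=> ?; exact: measurableT_comp.
pose f1 z := f0 (x, z).
have mf1 : measurable_fun setT f1 by exact: measurable_fun_pair2.
have If1i : P.-integrable setT (EFin \o (fun t => I t * f1 (Z t))).
  rewrite (_ : EFin \o _ = EFin \o (fun t => f0 (X t, Z t) * I t)).
    by apply: integrable_mul_bounded.
  apply/funext => t /=; congr EFin; rewrite [RHS]mulrC.
  by apply: (I_eq (fun t => f1 (Z t)) (fun t => f0 (X t, Z t))) => s; rewrite /f1 => ->.
(* At this stage [f1 (Z t)] is controlled only on the event [X = x]; the nonnegative pull-out moves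
   the finite integral of [I * |f1|] to [ex * |f1|]. *)
have exf1i : P.-integrable setT (EFin \o (fun t => ex (Z t) * f1 (Z t))).
  apply/integrableP; split.
    by apply/measurable_EFinP; apply: (cZ (fun z => ex z * f1 z)); exact: measurable_funM.
  have mabs : measurable_fun setT (fun z => `|f1 z|) by exact: measurableT_comp.
  have h := cond_exp_version_ge0_pull P Z mZ _ _ _ Xex (fun t => ler0n _ _) ex0
    mabs (fun z => normr_ge0 _).
  rewrite (_ : (\int[P]_t _ = \int[P]_t (ex (Z t) * `|f1 (Z t)|)%:E)%E); last first.
    by apply: eq_integral => t _ /=; rewrite normrM (ger0_norm (ex0 _)).
  rewrite -h; case/integrableP : If1i => _; congr (_ < _)%E.
  by apply: eq_integral => t _ /=; rewrite normrM ger0_norm.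
have mC C (mC : measurable C) : measurable_fun setT (fun t => \1_C (Z t) : R).
  exact: (cZ \1_C).
have C1 (C : set TZ) : forall t, `|\1_C (Z t)| <= 1 :> R.
  by move=> t; exact: normr_indic_le1.
(* [ex * f1] and [ex * mux] are both versions of the conditional expectation of
   [I * Y] given [Z]; positivity then allows cancelling [ex]. *)
have v1 : cond_exp_version P Z (fun t => I t * Y t) (fun z => ex z * f1 z).
  split.
  - by under eq_fun do rewrite mulrC; exact: integrable_mul_bounded.
  - exact: measurable_funM.
  - exact: exf1i.
  move=> C mC'; rewrite !(integral_preimage P Z)//.
  transitivity (\int[P]_t (I t * (f1 (Z t) * \1_C (Z t)))%:E)%E; last first.
    rewrite (cond_exp_version_pull_out P Z mZ _ _ (fun z => f1 z * \1_C z) Xex).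
    + by apply: eq_integral => t _; rewrite mulrA.
    + exact: measurable_funM.
    + by under eq_fun do rewrite /= mulrA; exact: (integrable_mul_bounded _ _ (mC C mC')).
    + by under eq_fun do rewrite /= mulrA; exact: (integrable_mul_bounded _ _ (mC C mC')).
  (* This test set for [f0] selects the arm: its indicator at [(X t, Z t)] is [I t * \1_C (Z t)]. *)
  have mxC : measurable ([set x] `*` C) by exact: measurableX.
  have := Yf' _ mxC.
  rewrite !(integral_preimage P (fun t => (X t, Z t)))//.
  have e t : \1_([set x] `*` C) (X t, Z t) = I t * \1_C (Z t) :> R.
    by rewrite /I !indicE in_setX -natrM mulnb.
  move=> h; transitivity (\int[P]_t (Y t * \1_([set x] `*` C) (X t, Z t))%:E)%E.
    by apply: eq_integral => t _; rewrite e; congr EFin; ring.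
  rewrite h; apply: eq_integral => t _; rewrite e mulrA (mulrC _ (I t)).
  by rewrite (I_eq (fun t => f0 (X t, Z t)) (fun t => f1 (Z t))) ?mulrA// => s; rewrite /f1 => ->.
have v2 : cond_exp_version P Z (fun t => I t * Y t) (fun z => mux z * ex z).
  have IpY t : I t * Y t = p (U t) * I t by rewrite [RHS]mulrC; apply: (I_eq Y (p \o U)).
  have pIi : P.-integrable setT (EFin \o (fun t => p (U t) * I t)).
    exact: integrable_mul_bounded.
  split.
  - by under eq_fun do rewrite IpY.
  - exact: measurable_funM.
  - by apply: integrable_mul_bounded => //; exact: cZ.
  move=> C mC'; rewrite !(integral_preimage P Z)//.
  (* Ignorability enters here: given [(U, Z)] the event [X = x] still has probability [ex (Z t)], so
     [I] can be replaced by [ex] in front of [p (U t)]. *)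
  have XUZ : cond_exp_version P (fun t => (U t, Z t)) (\1_(X @^-1` [set x]) : T -> R)
      (fun w => ex w.2).
    apply: cond_indep_version => // z.
    by case/andP: (ex01 z) => /ltW -> /ltW ->.
  have mUZ : measurable_fun setT (fun t => (U t, Z t)) by exact: measurable_fun_pair.
  pose phi (w : TU * TZ) := p w.1 * \1_C w.2.
  have mphi : measurable_fun setT phi.
    apply: measurable_funM; first exact: measurableT_comp.
    have m1 : measurable_fun setT (\1_C : TZ -> R) by exact: measurable_indic.
    exact: measurableT_comp m1 measurable_snd.
  have pCi : P.-integrable setT (EFin \o (fun t => p (U t) * \1_C (Z t))).
    exact: (integrable_mul_bounded _ _ (mC C mC')).
  transitivity (\int[P]_t (I t * phi (U t, Z t))%:E)%E.
    by apply: eq_integral => t _; rewrite IpY /phi/=; congr EFin; ring.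
  rewrite (cond_exp_version_pull_out P _ mUZ _ _ _ XUZ mphi).
  - transitivity (\int[P]_t ((p \o U) t * (ex (Z t) * \1_C (Z t)))%:E)%E.
      by apply: eq_integral => t _; rewrite /phi/=; congr EFin; ring.
    have bnd t : `|ex (Z t) * \1_C (Z t)| <= 1 by rewrite normrM mulr_ile1.
    have mb : measurable_fun setT (fun t => ex (Z t) * \1_C (Z t)).
      by apply: measurable_funM; [exact: cZ|exact: mC].
    rewrite (cond_exp_version_pull_out P Z mZ _ _ (fun z => ex z * \1_C z) pmu).
    + by apply: eq_integral => t _; rewrite mulrA.
    + exact: measurable_funM.
    + exact: (integrable_mul_bounded _ _ mb).
    + exact: (integrable_mul_bounded _ _ mb).
  - by under eq_fun do rewrite /= mulrC; exact: (integrable_mul_bounded _ _ mI I1 pCi).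
  - under eq_fun do rewrite /= mulrC.
    by apply: (integrable_mul_bounded _ _ _ _ pCi) => //; exact: cZ.
have := cond_exp_version_unique P Z mZ _ _ _ v1 v2.
apply: filterS => t; rewrite mulrC => /mulIf; apply.
by case/andP: (ex01 (Z t)) => /lt0r_neq0.
Qed.

(** [X] is the indicator of [X = 1], so [m = e] almost surely, and [X ^+ 2 = X] gives [(X - e) ^+ 2
    = (X - e) * (1 - 2 * e) + e * (1 - e)], whose first term has zero conditional mean. *)
Lemma binary_cond_variance {dZ} {TZ : measurableType dZ} (X : T -> R) (Z : T -> TZ)
    (e m v : TZ -> R) :
  measurable_fun setT Z ->
  (forall t, X t = 0 \/ X t = 1) ->
  cond_exp_version P Z (\1_(X @^-1` [set 1]) : T -> R) e ->
  (forall z, 0 < e z < 1) ->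
  cond_exp_version P Z X m ->
  cond_exp_version P Z (fun t => (X t - m (Z t)) ^+ 2) v ->
  {ae P, forall t, v (Z t) = e (Z t) * (1 - e (Z t))}.
Proof.
move=> mZ X01 Xe e01 Xm Xv.
have XE : X = \1_(X @^-1` [set 1]).
  apply/funext => t; rewrite indicE; have [Xt|Xt] := X01 t.
    by rewrite memNset//= Xt => /esym/eqP; rewrite oner_eq0.
  by rewrite mem_set.
rewrite -XE in Xe.
have em := cond_exp_version_unique P Z mZ _ _ _ Xm Xe.
have [Xi me ei _] := Xe; have [vi _ _ hv] := Xv.
have mX := integrable_measurable _ Xi.
have meZ : measurable_fun setT (fun t => e (Z t)) by exact: measurableT_comp.
have [_ mm _ _] := Xm.
have mmZ : measurable_fun setT (fun t => m (Z t)) by exact: measurableT_comp.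
have eb z : `|1 - e z| <= 1 /\ `|1 - e z *+ 2| <= 1.
  by case/andP: (e01 z) => e0 e1; rewrite !ler_norml; split; apply/andP; split; lra.
have eei : P.-integrable setT (EFin \o (fun t => e (Z t) * (1 - e (Z t)))).
  apply: integrable_mul_bounded => //; first exact: measurable_funB.
  by move=> t; have [] := eb (Z t).
suff Xee : cond_exp_version P Z (fun t => (X t - m (Z t)) ^+ 2)
    (fun z => e z * (1 - e z)).
  exact: (cond_exp_version_unique P Z mZ _ _ _ Xv Xee).
split => //.
  by apply: measurable_funM => //; exact: measurable_funB.
move=> C mC; rewrite !(integral_preimage P Z)//.
have mCZ : measurable_fun setT (fun t => \1_C (Z t) : R) by exact: measurableT_comp.
pose phi z := (1 - e z *+ 2) * \1_C z.
have mphi : measurable_fun setT phi.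
  apply: measurable_funM => //; apply: measurable_funB => //.
  by under eq_fun do rewrite mulr2n; exact: measurable_funD.
have mphiZ : measurable_fun setT (fun t => phi (Z t)) by exact: measurableT_comp.
have phi1 t : `|phi (Z t)| <= 1.
  by rewrite normrM mulr_ile1//; [have [] := eb (Z t)|exact: normr_indic_le1].
have UI : P.-integrable setT (EFin \o (fun t => (X t - e (Z t)) * phi (Z t))).
  apply: integrable_mul_bounded => //.
  exact: (integrableB measurableT Xi ei).
have eCi : P.-integrable setT (EFin \o (fun t => e (Z t) * (1 - e (Z t)) * \1_C (Z t))).
  by apply: integrable_mul_bounded => // t; exact: normr_indic_le1.
transitivity (\int[P]_t ((X t - e (Z t)) * phi (Z t) +
    e (Z t) * (1 - e (Z t)) * \1_C (Z t))%:E)%E; last first.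
  rewrite integralD_real//.
  by rewrite (cond_exp_version_pull P Z mZ _ _ _ Xe mphi UI) add0e.
apply: ae_eq_integral => //.
- apply/measurable_EFinP/measurable_funM => //; apply: measurable_funX.
  exact: measurable_funB.
- exact: measurable_int (integrableD measurableT UI eCi).
- move: em; apply: filterS => t emt _; rewrite emt /phi; congr EFin.
  by have [->|->] := X01 t; rewrite mulr2n; ring.
Qed.

End conditional_independence.

(** * The importance of a binary treatment as a weighted squared conditional effect *)

Theorem theorem3 (R : realType) (d : measure_display) (T : measurableType d)
  (P : probability T R) (dz : measure_display) (Tz : measurableType dz)
  (Y X Xb Y0 Y1 : T -> R) (Z : T -> Tz)
  (f0 : R * Tz -> R) (e m v mu0 mu1 : Tz -> R) :
  measurable_fun setT Y -> measurable_fun setT X ->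
  measurable_fun setT Xb -> measurable_fun setT Y0 ->
  measurable_fun setT Y1 -> measurable_fun setT Z ->
  (* X is binary *)
  (forall t, X t = 0 \/ X t = 1) ->
  (* E[Y^2] < oo *)
  P.-integrable setT (fun t => (Y t ^+ 2)%:E) ->
  (* f0(x, z) = E(Y | X = x, Z = z) *)
  cond_exp_version P (fun t => (X t, Z t)) Y f0 ->
  (* Xb | Z ~ X | Z, and Xb _||_ (Y, X) | Z *)
  same_cond_law P X Xb Z ->
  cond_indep P Xb (fun t => (Y t, X t)) Z ->
  (* e_cond is finite *)
  P.-integrable setT (fun t => ((Y t - f0 (Xb t, Z t)) ^+ 2)%:E) ->
  (* consistency Y = Y_X *)
  (forall t, (X t = 0 -> Y t = Y0 t) /\ (X t = 1 -> Y t = Y1 t)) ->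
  (* conditional ignorability (Y0, Y1) _||_ X | Z *)
  cond_indep P (fun t => (Y0 t, Y1 t)) X Z ->
  (* positivity: e(z) = P(X = 1 | Z = z) in (0, 1) for all z *)
  cond_exp_version P Z (\1_(X @^-1` [set 1]) : T -> R) e ->
  (forall z, 0 < e z < 1) ->
  (* v(z) = V(X | Z = z) = E[(X - E(X|Z))^2 | Z = z] *)
  cond_exp_version P Z X m ->
  cond_exp_version P Z (fun t => (X t - m (Z t)) ^+ 2) v ->
  (* mu_x(z) = E(Y_x | Z = z) *)
  cond_exp_version P Z Y0 mu0 ->
  cond_exp_version P Z Y1 mu1 ->
  (\int[P]_t ((Y t - f0 (Xb t, Z t)) ^+ 2)%:E
     - \int[P]_t ((Y t - f0 (X t, Z t)) ^+ 2)%:E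
   = 2%:E * \int[P]_t (v (Z t) * (mu1 (Z t) - mu0 (Z t)) ^+ 2)%:E)%E.
Proof.
move=> mY mX mXb mY0 mY1 mZ X01 Y2i Yf slaw XbYX Fi0 cons UX Xe e01 Xm Xv Yv0 Yv1.

(* Conditional probabilities of [X] and of its copy, and the two arms of [f0] *)
have [_ mf _ _] := Yf; have [_ me _ _] := Xe.
have e0 z : 0 <= e z by case/andP: (e01 z) => /ltW.
have e1 z : 0 <= 1 - e z by case/andP: (e01 z); lra.
have XE0 : (\1_(X @^-1` [set 0]) : T -> R) = (fun t => 1 - \1_(X @^-1` [set 1]) t).
  apply/funext => t; rewrite !indicE; have [Xt|Xt] := X01 t.
    rewrite mem_set// memNset ?subr0//= Xt => /esym/eqP.
    by rewrite oner_eq0.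
  rewrite [in RHS]mem_set// memNset ?subrr//= Xt => /eqP.
  by rewrite oner_eq0.
have Xe0 : cond_exp_version P Z (\1_(X @^-1` [set 0]) : T -> R) (fun z => 1 - e z).
  by rewrite XE0; exact: cond_exp_version_onem.
have mU : measurable_fun setT (fun t => (Y0 t, Y1 t)) by exact: measurable_fun_pair.
have mXZ : measurable_fun setT (fun t => (X t, Z t)) by exact: measurable_fun_pair.
have mYX : measurable_fun setT (fun t => (Y t, X t)) by exact: measurable_fun_pair.
have mYXZ : measurable_fun setT (fun t => ((Y t, X t), Z t)) by exact: measurable_fun_pair.
have arm1 : {ae P, forall t, f0 (1, Z t) = mu1 (Z t)}.
  apply: (regression_arm P X Y Z (fun t => (Y0 t, Y1 t)) snd 1 f0 e mu1) => //.
  by move=> t; have [_] := cons t.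
have arm0 : {ae P, forall t, f0 (0, Z t) = mu0 (Z t)}.
  apply: (regression_arm P X Y Z (fun t => (Y0 t, Y1 t)) fst 0 f0
    (fun z => 1 - e z) mu0) => //.
  - by move=> t; have [] := cons t.
  - by move=> z; case/andP: (e01 z) => ? ?; apply/andP; split; lra.
have ve := binary_cond_variance P X Z e m v mZ X01 Xe e01 Xm Xv.
pose B1 : T -> R := \1_(Xb @^-1` [set 1]); pose B0 : T -> R := \1_(Xb @^-1` [set 0]).
have m1 (x : R) : measurable [set x] by [].
have Xbe1 : cond_exp_version P Z B1 e.
  exact: (same_cond_law_version P X Xb Z [set 1] e slaw (m1 1) Xe).
have Xbe0 : cond_exp_version P Z B0 (fun z => 1 - e z).
  exact: (same_cond_law_version P X Xb Z [set 0] _ slaw (m1 0) Xe0).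
(* Only the law of [Xb] is known, so it is binary merely almost surely: sharing the conditional law
   of [X] gives the set of values 0 and 1 full probability. *)
have Xb01 : {ae P, forall t, Xb t = 0 \/ Xb t = 1}.
  have mB : measurable ([set 0; 1] : set R) by exact: measurableU.
  have [h [[_ _ _ hX] [_ _ _ hXb]]] := slaw _ mB.
  have mXbB : measurable (Xb @^-1` [set 0; 1]) by exact: (measurable_preimage Xb).
  have mXB : measurable (X @^-1` [set 0; 1]) by exact: (measurable_preimage X).
  have : P (Xb @^-1` [set 0; 1]) = 1%E.
    have := hXb setT measurableT; rewrite -hX// preimage_setT !integral_indic// !setIT => ->.
    rewrite -(@probability_setT _ _ _ P); congr (P _); apply/seteqP; split => // t _ /=.
    exact: X01.
  move=> PB; exists (~` (Xb @^-1` [set 0; 1])); split.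
  - exact: measurableC.
  - by rewrite probability_setC// PB subee.
  - exact: subsetC.
have XbYX' := cond_indepC P _ _ _ XbYX.
have e01' z : 0 <= e z <= 1 by case/andP: (e01 z) => /ltW -> /ltW ->.
have vB1 : cond_exp_version P (fun t => ((Y t, X t), Z t)) B1 (fun w => e w.2).
  exact: (cond_indep_version P _ Xb Z [set 1] e mYX mZ XbYX' (m1 1) Xbe1 e01').
have vB0 : cond_exp_version P (fun t => ((Y t, X t), Z t)) B0 (fun w => 1 - e w.2).
  have e10 z : 0 <= 1 - e z <= 1 by rewrite e1 /=; have := e0 z; lra.
  exact: (cond_indep_version P _ Xb Z [set 0] _ mYX mZ XbYX' (m1 0) Xbe0 e10).
have mf1 : measurable_fun setT (fun z => f0 (1, z)) by exact: measurable_fun_pair2.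
have mf0 : measurable_fun setT (fun z => f0 (0, z)) by exact: measurable_fun_pair2.

(* The integrands and their measurability *)
pose f1 z := f0 (1, z); pose fz z := f0 (0, z).
pose F t := e (Z t) * (Y t - f1 (Z t)) ^+ 2 + (1 - e (Z t)) * (Y t - fz (Z t)) ^+ 2.
pose g t := f0 (X t, Z t).
pose G t := (Y t - g t) ^+ 2.
pose del z := f1 z - fz z.
(* Written with indicators so that both summands fit [ge0_integral_pull2]. *)
pose K t := \1_(X @^-1` [set 1]) t * ((1 - e (Z t)) * del (Z t) ^+ 2)
          + \1_(X @^-1` [set 0]) t * (e (Z t) * del (Z t) ^+ 2).
pose phi (w : R * Tz) := 2 * del w.2 * (w.1 - e w.2).
pose Q t := e (Z t) * f1 (Z t) ^+ 2 + (1 - e (Z t)) * fz (Z t) ^+ 2.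
have cZ (f : Tz -> R) : measurable_fun setT f -> measurable_fun setT (fun t => f (Z t)).
  by move=> ?; exact: measurableT_comp.
have m1e : measurable_fun setT (fun z => 1 - e z) by exact: measurable_funB.
have mdel : measurable_fun setT del by exact: measurable_funB.
have mdel2 : measurable_fun setT (fun z => del z ^+ 2) by exact: measurable_funX.
have mf12 : measurable_fun setT (fun z => f1 z ^+ 2) by exact: measurable_funX.
have mfz2 : measurable_fun setT (fun z => fz z ^+ 2) by exact: measurable_funX.
have mg : measurable_fun setT g by exact: measurableT_comp.
have mG : measurable_fun setT G by apply: measurable_funX; exact: measurable_funB.
have mQ : measurable_fun setT Q.
  apply: (cZ (fun z => e z * f1 z ^+ 2 + (1 - e z) * fz z ^+ 2)).
  by apply: measurable_funD; exact: measurable_funM.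
have mYf (f : Tz -> R) : measurable_fun setT f ->
    measurable_fun setT (fun t => (Y t - f (Z t)) ^+ 2).
  by move=> mf'; apply: measurable_funX; apply: measurable_funB => //; exact: cZ.
have mF : measurable_fun setT F.
  by apply: measurable_funD; apply: measurable_funM;
    [exact: cZ|exact: mYf|exact: (cZ (fun z => 1 - e z))|exact: mYf].
have mI (x : R) : measurable_fun setT (\1_(X @^-1` [set x]) : T -> R).
  by apply: measurable_indic; exact: (measurable_preimage X).
have mIb (x : R) : measurable_fun setT (\1_(Xb @^-1` [set x]) : T -> R).
  by apply: measurable_indic; exact: (measurable_preimage Xb).
have m1ed : measurable_fun setT (fun z => (1 - e z) * del z ^+ 2) by exact: measurable_funM.
have med : measurable_fun setT (fun z => e z * del z ^+ 2) by exact: measurable_funM.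
have mK : measurable_fun setT K.
  by apply: measurable_funD; apply: measurable_funM => //;
    [exact: (cZ _ m1ed)|exact: (cZ _ med)].
have mYXf (f : Tz -> R) : measurable_fun setT f ->
    measurable_fun setT (fun w : R * R * Tz => (w.1.1 - f w.2) ^+ 2).
  move=> mf'; apply: measurable_funX; apply: measurable_funB.
    exact: measurableT_comp measurable_fst measurable_fst.
  exact: measurableT_comp mf' measurable_snd.
have F0 t : 0 <= F t by rewrite addr_ge0// mulr_ge0// sqr_ge0.
(* Carries integrability across an equality of integrals of nonnegative functions. *)
have fin (f : T -> R) (h : T -> R) : measurable_fun setT f -> (forall t, 0 <= f t) ->
    P.-integrable setT (EFin \o h) -> (forall t, 0 <= h t) ->
    (\int[P]_t (h t)%:E = \int[P]_t (f t)%:E)%E -> P.-integrable setT (EFin \o f).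
  move=> mf' f0' /integrableP[_ hoo] h0 hf; apply/integrableP; split.
    exact/measurable_EFinP.
  apply: le_lt_trans hoo; rewrite le_eqVlt; apply/orP; left; apply/eqP.
  rewrite -[RHS](_ : \int[P]_t (h t)%:E = _)%E; last first.
    by apply: eq_integral => t _ /=; rewrite ger0_norm.
  by rewrite hf; apply: eq_integral => t _ /=; rewrite ger0_norm.

(* Averaging out the copy [Xb] *)
have econd : (\int[P]_t ((Y t - f0 (Xb t, Z t)) ^+ 2)%:E = \int[P]_t (F t)%:E)%E.
  (* The loss is almost surely [B1 * (Y - f1) ^+ 2 + B0 * (Y - fz) ^+ 2], whose squares depend on
     [((Y, X), Z)] alone. *)
  have := ge0_integral_pull2 P (fun t => ((Y t, X t), Z t)) mYXZ B1 B0 _ _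
    (fun w => (w.1.1 - f1 w.2) ^+ 2) (fun w => (w.1.1 - fz w.2) ^+ 2) vB1 vB0.
  rewrite /= -/F => <-//.
  - apply: ae_eq_integral => //.
    + exact: (measurable_int _ Fi0).
    + apply/measurable_EFinP; apply: measurable_funD; apply: measurable_funM;
        [exact: mIb|exact: mYf|exact: mIb|exact: mYf].
    + move: Xb01; apply: filterS => t Xbt _; congr EFin; rewrite /B1 /B0 !indicE.
      have [Xt|Xt] := Xbt.
        rewrite memNset ?mem_set//= ?mul0r ?add0r ?mul1r ?Xt// => /esym/eqP.
        by rewrite oner_eq0.
      rewrite mem_set// memNset//= ?mul0r ?addr0 ?mul1r ?Xt// => /eqP.
      by rewrite oner_eq0.
  - exact: mYXf.
  - exact: mYXf.
  - by move=> w; exact: sqr_ge0.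
  - by move=> w; exact: sqr_ge0.
have Fi : P.-integrable setT (EFin \o F).
  by apply: fin econd => // t; exact: sqr_ge0.
have I01 t :
    (X t = 0 ->
      \1_(X @^-1` [set 1]) t = 0 :> R /\ \1_(X @^-1` [set 0]) t = 1 :> R) /\
    (X t = 1 ->
      \1_(X @^-1` [set 1]) t = 1 :> R /\ \1_(X @^-1` [set 0]) t = 0 :> R).
  split=> Xt; rewrite !indicE.
    by rewrite memNset ?mem_set//= Xt => /esym/eqP; rewrite oner_eq0.
  by rewrite mem_set// memNset//= Xt => /eqP; rewrite oner_eq0.
have sq_int (f h h' : T -> R) : measurable_fun setT f -> (forall t, 0 <= f t) ->
    P.-integrable setT (EFin \o h) -> P.-integrable setT (EFin \o h') ->
    (forall t, f t <= 2 * (h t + h' t)) -> P.-integrable setT (EFin \o f).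
  move=> mf' f0' hi h'i fh.
  apply: (le_integrable_EFin _ (fun t => 2 * (h t + h' t))) => //.
    by move=> t; rewrite ger0_norm// (le_trans (fh t))// ler_norm.
  exact: (integrableZl measurableT 2 (integrableD measurableT hi h'i)).

(* Integrability of [Q], [G] and [K], and the pointwise decomposition *)
have Qi : P.-integrable setT (EFin \o Q).
  apply: (sq_int _ F (fun t => Y t ^+ 2)) => //.
    by move=> t; rewrite addr_ge0// mulr_ge0// sqr_ge0.
  move=> t; rewrite /Q /F.
  have := e0 (Z t); have := e1 (Z t); move: (e (Z t)) (f1 (Z t)) (fz (Z t)) (Y t).
  move=> a b c y a1 a0.
  (* This is exactly the slack [2 * (F + Y ^+ 2) - Q]. *)
  have : 0 <= a * (2 * y - b) ^+ 2 + (1 - a) * (2 * y - c) ^+ 2.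
    by rewrite addr_ge0// mulr_ge0// sqr_ge0.
  by nra.
(* [Q] is the conditional second moment of [g] given [Z]: split [g ^+ 2] over the two values of
   [X]. *)
have g2 : (\int[P]_t (Q t)%:E = \int[P]_t (g t ^+ 2)%:E)%E.
  rewrite -(ge0_integral_pull2 P Z mZ _ _ e (fun z => 1 - e z) (fun z => f1 z ^+ 2)
     (fun z => fz z ^+ 2) Xe Xe0)//; last 2 first.
  - by move=> z; exact: sqr_ge0.
  - by move=> z; exact: sqr_ge0.
  apply: eq_integral => t _; congr EFin; rewrite /g /f1 /fz.
  have [h0 h1] := I01 t; have [Xt|Xt] := X01 t.
    by have [-> ->] := h0 Xt; rewrite Xt mul0r add0r mul1r.
  by have [-> ->] := h1 Xt; rewrite Xt mul0r addr0 mul1r.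
have g2i : P.-integrable setT (EFin \o (fun t => g t ^+ 2)).
  apply: fin g2 => //; first exact: measurable_funX.
  - by move=> t; exact: sqr_ge0.
  - by move=> t; rewrite addr_ge0// mulr_ge0// sqr_ge0.
have Gi : P.-integrable setT (EFin \o G).
  apply: (sq_int _ (fun t => Y t ^+ 2) (fun t => g t ^+ 2)) => //.
    by move=> t; exact: sqr_ge0.
  by move=> t; rewrite /G; have := sqr_ge0 (Y t + g t); nra.
have FGK t : F t - G t = (Y t - g t) * phi (X t, Z t) + K t.
  rewrite /F /G /K /phi /g /del /f1 /fz/=.
  have [h0 h1] := I01 t; have [Xt|Xt] := X01 t.
    by have [-> ->] := h0 Xt; rewrite Xt; ring.
  by have [-> ->] := h1 Xt; rewrite Xt; ring.
have K0 t : 0 <= K t.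
  by apply: addr_ge0; apply: mulr_ge0 => //; apply: mulr_ge0 => //; exact: sqr_ge0.
have Ki : P.-integrable setT (EFin \o K).
  apply: (sq_int _ F G) => // t.
  have a0 := e0 (Z t); have a1 := e1 (Z t).
  rewrite /F /G /K /g /del /f1 /fz/=.
  have [h0 h1] := I01 t; have [Xt|Xt] := X01 t.
    have [-> ->] := h0 Xt; rewrite Xt.
    set a := e _ in a0 a1 *; move: (f0 (1, Z t)) (f0 (0, Z t)) (Y t) => b c y.
    (* By the parallelogram law the slack [2 * (F + G) - K] on [X = 0] is this term plus four times
       the next one; the case [X = 1] is symmetric. *)
    have : 0 <= a * (2 * y - b - c) ^+ 2 by rewrite mulr_ge0// sqr_ge0.
    have : 0 <= (1 - a) * (y - c) ^+ 2 by rewrite mulr_ge0// sqr_ge0.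
    by nra.
  have [-> ->] := h1 Xt; rewrite Xt.
  set a := e _ in a0 a1 *; move: (f0 (1, Z t)) (f0 (0, Z t)) (Y t) => b c y.
  have : 0 <= a * (y - b) ^+ 2 by rewrite mulr_ge0// sqr_ge0.
  have : 0 <= (1 - a) * (2 * y - b - c) ^+ 2 by rewrite mulr_ge0// sqr_ge0.
  by nra.

(* Vanishing of the cross term and evaluation of the integral of [K] *)
pose H t := (Y t - g t) * phi (X t, Z t).
have Hi : P.-integrable setT (EFin \o H).
  rewrite (_ : EFin \o H = ((EFin \o F) \- (EFin \o G)) \- (EFin \o K))%E.
    exact: (integrableB measurableT (integrableB measurableT Fi Gi) Ki).
  by apply/funext => t /=; congr EFin; rewrite FGK /H; ring.
have mphi : measurable_fun setT phi.
  apply: measurable_funM.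
    by apply: measurable_funM => //; exact: measurableT_comp mdel measurable_snd.
  apply: measurable_funB => //; exact: measurableT_comp me measurable_snd.
have H0 : (\int[P]_t (H t)%:E = 0)%E.
  exact: (cond_exp_version_pull P _ mXZ _ _ _ Yf mphi Hi).
rewrite econd -integralB_real//.
under eq_integral do rewrite FGK.
rewrite integralD_real// H0 add0e.
(* The factor 2 arises here: replacing each indicator by its conditional probability, both arms
   contribute [e * (1 - e) * del ^+ 2]. *)
have -> : (\int[P]_t (K t)%:E =
    \int[P]_t (2%:E * (e (Z t) * (1 - e (Z t)) * del (Z t) ^+ 2)%:E))%E.
  rewrite (ge0_integral_pull2 P Z mZ _ _ e (fun z => 1 - e z)
    (fun z => (1 - e z) * del z ^+ 2)
    (fun z => e z * del z ^+ 2) Xe Xe0)//.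
  - by apply: eq_integral => t _; rewrite -EFinM; congr EFin; ring.
  - by move=> z; rewrite mulr_ge0// sqr_ge0.
  - by move=> z; rewrite mulr_ge0// sqr_ge0.
have mR : measurable_fun setT (fun t => e (Z t) * (1 - e (Z t)) * del (Z t) ^+ 2).
  apply: (cZ (fun z => e z * (1 - e z) * del z ^+ 2)).
  by apply: measurable_funM => //; exact: measurable_funM.
rewrite ge0_integralZl_EFin//; last 2 first.
- by move=> t _; rewrite lee_fin mulr_ge0 ?sqr_ge0// mulr_ge0.
- exact/measurable_EFinP.
congr (_ * _)%E; apply: ae_eq_integral => //.
- exact/measurable_EFinP.
- have [_ mv _ _] := Xv; have [_ mm0 _ _] := Yv0; have [_ mm1 _ _] := Yv1.
  apply/measurable_EFinP.
  apply: (cZ (fun z => v z * (mu1 z - mu0 z) ^+ 2)).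
  by apply: measurable_funM => //; apply: measurable_funX; exact: measurable_funB.
- move: ve arm1 arm0; apply: filterS3 => t vt a1 a0 _.
  by rewrite vt -a1 -a0.
Qed.
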